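(* Let $D$ be a diagram in the plane with $n$ boxes (with a fixed reading order) and let $\mathrm{StdTab}(D)$ be an ascent-compatible subset of $\mathrm{StdFill}(D)$. Then $$\widetilde{ch}([\widetilde{\mathbf{N}}_{\mathrm{StdTab}(D)}])=\sum_{T\in \mathrm{StdTab}(D)}K_{\mathrm{comp}_n(\mathrm{Peak}(T))}.$$
   Context: Compositions. A composition $\alpha=(\alpha_1,\dots,\alpha_k)\vDash n$ is a sequence of positive integers with sum $n$; $\mathrm{Des}(\alpha)=\{\alpha_1,\alpha_1+\alpha_2,\dots,\alpha_1+\cdots+\alpha_{k-1}\}\subseteq [n-1]$, where $[m]=\{1,\dots,m\}$. This is a bijection from compositions of $n$ to subsets of $[n-1]$; $\mathrm{comp}_n(X)$ is the composition of $n$ with descent set $X$. For a set $X$ of positive integers, $\mathrm{Peak}(X)=\{i\in X: i>1,\ i-1\notin X\}$; $\mathrm{Peak}(\alpha)=\mathrm{Peak}(\mathrm{Des}(\alpha))$. A peak composition is a composition all of whose parts, except possibly the last, are greater than $1$. Functions. For $\alpha\vDash n$, $F_\alpha=\sum x_{i_1}\cdots x_{i_n}$ over positive integers $i_1\le\cdots\le i_n$ with $i_j<i_{j+1}$ whenever $j\in\mathrm{Des}(\alpha)$. For a peak composition $\alpha\vDash n$, $K_\alpha=2^{|\mathrm{Peak}(\alpha)|+1}\sum_\beta F_\beta$, sum over $\beta\vDash n$ with $\mathrm{Peak}(\alpha)\subseteq \mathrm{Des}(\beta)\triangle(\mathrm{Des}(\beta)+1)$ ($\triangle$ is symmetric difference,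 $X+1=\{x+1:x\in X\}$). The peak algebra $\mathsf{Peak}$ has basis the functions $K_\alpha$. Algebras. $H_n(0)$ is the $\mathbb{C}$-algebra with generators $\pi_1,\dots,\pi_{n-1}$ and relations $\pi_i^2=-\pi_i$, $\pi_i\pi_j=\pi_j\pi_i$ for $|i-j|\ge2$, $\pi_i\pi_{i+1}\pi_i=\pi_{i+1}\pi_i\pi_{i+1}$. $HCl_n(0)$ is generated by $\pi_1,\dots,\pi_{n-1}$ (with these relations) and $c_1,\dots,c_n$ with $c_i^2=-1$, $c_ic_j=-c_jc_i$ for $i\ne j$, and $\pi_ic_j=c_j\pi_i$ for $j\ne i,i+1$, $\pi_ic_i=c_{i+1}\pi_i$, $(\pi_i+1)c_{i+1}=c_i(\pi_i+1)$. It is a superalgebra with $\pi_i$ of degree $0$, $c_j$ of degree $1$. Characteristic. For $\alpha\vDash n$, $\mathbf{F}_\alpha=\mathbb{C}v_\alpha$ is the simple $H_n(0)$-module with $\pi_iv_\alpha=-v_\alpha$ if $i\in\mathrm{Des}(\alpha)$ and $0$ otherwise, and $\mathbf{M}_\alpha$ is the $HCl_n(0)$-supermodule induced from $\mathbf{F}_\alpha$. The peak characteristic $\widetilde{ch}$ is the isomorphism of Bergeron, Hivert and Thibon from $\bigoplus_n\mathcal{G}_0(HCl_n(0))$ (Grothendieck groups of finite-dimensional supermodules) to $\mathsf{Peak}$, which satisfies $\widetilde{ch}([\mathbf{M}_\alpha])=K_{\mathrm{comp}_n(\mathrm{Peak}(\alpha))}$ for $\alpha\vDash n$. Diagram modules.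 $\mathrm{StdFill}(D)$ is the set of bijective assignments of $1,\dots,n$ to the boxes of $D$. A reading order is a total order on the boxes; $\mathrm{rw}(T)$ is the permutation given by the entries of $T$ in reading order from left to right. $s_iT$ exchanges the entries $i,i+1$ of $T$. For a nonempty $\mathrm{StdTab}(D)\subseteq\mathrm{StdFill}(D)$ and $T\in\mathrm{StdTab}(D)$, $\mathrm{Des}(T)$ is the set of $i\in[n-1]$ with $i$ to the right of $i+1$ in $\mathrm{rw}(T)$, and $\mathrm{Peak}(T)=\mathrm{Peak}(\mathrm{Des}(T))$. Elements of $[n-1]\setminus\mathrm{Des}(T)$ are ascents; an ascent $i$ is attacking if $s_iT\notin\mathrm{StdTab}(D)$ and nonattacking otherwise. $T$ has an ascent in positions $(r,s)$ if $r<s$ and $\mathrm{rw}(T)_s-\mathrm{rw}(T)_r=1$. $\mathrm{StdTab}(D)$ is ascent-compatible if whenever $T,T'\in\mathrm{StdTab}(D)$ both have an ascent in positions $(r,s)$, it is attacking in $T$ if and only if it is attacking in $T'$. In that case $\mathbf{N}_{\mathrm{StdTab}(D)}$ is the $H_n(0)$-module on the $\mathbb{C}$-span of $\mathrm{StdTab}(D)$ with $\pi_iT=-T$ if $i\in\mathrm{Des}(T)$, $0$ if $i$ is an attacking ascent, $s_iT$ if $i$ is a nonattacking ascent; and $\widetilde{\mathbf{N}}_{\mathrm{StdTab}(D)}=\mathrm{Ind}_{H_n(0)}^{HCl_n(0)}\mathbf{N}_{\mathrm{StdTab}(D)}$. It has basis $\{c_XT: X\subseteq[n],T\in\mathrm{StdTab}(D)\}$,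 where $c_X=c_{i_1}\cdots c_{i_k}$ for $X=\{i_1<\cdots<i_k\}$, and $c_XT$ has degree $|X|$ mod $2$. *)

(* Defs.v *)
From HB Require Import structures.
From mathcomp Require Import all_boot all_order all_algebra.
From mathcomp Require Import generic_quotient ring_quotient.
From mathcomp Require Import finmap multiset freeg complex.
From mathcomp Require Import zify.
From mathcomp Require Import boolp classical_sets functions fsbigop reals.

Set Implicit Arguments.
Unset Strict Implicit.
Unset Printing Implicit Defensive.

Import Order.TTheory GRing.Theory Num.Theory.

(* A composition of n is a sequence of positive natural numbers; descent sets
   and peak sets are finite sets of positive natural numbers.  All indices of
   generators, entries and variables are 1-based natural numbers. *)
Definition is_comp (n : nat) (al : seq nat) : bool :=
  all (leq 1) al && (sumn al == n).

Definition CDes (al : seq nat) : {fset nat} :=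
  [fset sumn (take k al) | k in iota 1 (size al).-1]%fset.

Definition comp_of (n : nat) (X : {fset nat}) : seq nat :=
  if n == 0%N then [::]
  else pairmap (fun a b => (b - a)%N) 0%N (rcons (sort leq X) n).

Lemma sumn_pairmap x s k : path leq x s -> k <= size s ->
  sumn (take k (pairmap (fun a b => b - a) x s)) + x = nth 0 (x :: s) k.
Proof.
elim: s x k => [|y s IH] x [|k] //= /andP[xy ys] ks.
have := IH y k ys ks; case: k ks => [|k] /= ks; lia.
Qed.

Lemma comp_ofP n (X : {fset nat}) : (forall x, x \in X -> 0 < x < n) ->
  is_comp n (comp_of n X) /\ CDes (comp_of n X) = X.
Proof.
rewrite /comp_of => Xn; case: eqP => [n0|n0].
  split; first by rewrite /is_comp n0.
  apply/fsetP => x; apply/imfsetP/idP => [[k] //|/Xn]; lia.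
set s := sort leq X; have memS : s =i X by move=> x; rewrite mem_sort.
have ltS : path ltn 0 (rcons s n).
  rewrite rcons_path; apply/andP; split.
    rewrite path_min_sorted; last by apply/allP => x; rewrite memS => /Xn /andP[].
    by rewrite ltn_sorted_uniq_leq sort_uniq fset_uniq sort_sorted //; exact: leq_total.
  by have := mem_last 0 s; rewrite inE => /orP[/eqP->|]; [lia|rewrite memS => /Xn/andP[]].
have leS : path leq 0 (rcons s n) by apply: sub_path ltS => x y /ltnW.
have sumE k : k <= (size s).+1 ->
    sumn (take k (pairmap (fun a b => b - a) 0 (rcons s n))) = nth 0 (0 :: rcons s n) k.
  by move=> ks; rewrite -(sumn_pairmap leS) ?size_rcons // addn0.
split.
  apply/andP; split.
    have pos x t : path ltn x t -> all (leq 1) (pairmap (fun a b => b - a) x t).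
      by elim: t x => //= y t IH x /andP[xy /IH->]; rewrite subn_gt0 xy.
    exact: pos ltS.
  have := sumE (size s).+1 (leqnn _); rewrite take_oversize ?size_pairmap ?size_rcons // => ->.
  by rewrite /= nth_rcons ltnn eqxx.
apply/fsetP => x; rewrite -memS /CDes size_pairmap size_rcons /=.
apply/imfsetP/idP => /=.
  case=> -[|k]; rewrite mem_iota ?add1n //= ltnS => ks ->.
  by rewrite sumE 1?ltnW //= nth_rcons ks mem_nth.
move=> xs; exists (index x s).+1; first by rewrite mem_iota /= add1n ltnS index_mem.
by rewrite sumE /= ?nth_rcons ?index_mem ?xs ?nth_index // ltnS ltnW // index_mem.
Qed.

Definition Peak (X : {fset nat}) : {fset nat} :=
  [fset i in X | (1 < i) && (i.-1 \notin X)]%fset.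

Definition is_peak_comp (n : nat) (al : seq nat) : bool :=
  is_comp n al && all (ltn 1) (take (size al).-1 al).

Local Open Scope ring_scope.
Local Open Scope quotient_scope.

(* Formal power series in x_1, x_2, ...: a monomial is the multiset of the
   indices of its variables. *)
Definition fps : Type := {mset nat}%mset -> rat^o.
HB.instance Definition _ := GRing.Lmodule.copy fps ({mset nat}%mset -> rat^o).

(* The sequences i_1 <= ... <= i_n in the definition of F_al; i_j is
   nth 0 s j.-1. *)
Definition Findex (al s : seq nat) : Prop :=
  [/\ size s = sumn al, all (leq 1) s, sorted leq s &
      forall j, j \in CDes al -> (nth 0 s j.-1 < nth 0 s j)%N].

Definition Fqsym (al : seq nat) : fps := fun m =>
  \sum_(s \in [set s | Findex al s /\ seq_mset s = m]%classic) (1 : rat).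

Definition shift1 (X : {fset nat}) : {fset nat} := [fset x.+1 | x in X]%fset.

Definition symdiff (X Y : {fset nat}) : {fset nat} :=
  ((X `\` Y) `|` (Y `\` X))%fset.

Definition Kpeak (al : seq nat) : fps :=
  2 ^+ (#|` Peak (CDes al)|.+1) *:
  \sum_(be \in [set be | is_comp (sumn al) be /\
        (Peak (CDes al) `<=` symdiff (CDes be) (shift1 (CDes be)))%fset]%classic)
     Fqsym be.

(* Modules over the presented algebras H_n(0) and HCl_n(0) are coordinate spaces
   with operators satisfying the defining relations.  A matrix acts on column
   vectors, so that *m is composition.  Only the values of pi at 1, ..., n-1 and
   of c at 1, ..., n are meaningful: every relation and every morphism condition
   is guarded accordingly. *)
Section HeckeClifford.
Variable C : fieldType.
Variable n : nat.

Definition hecke_rel d (pi : nat -> 'M[C]_d) : Prop :=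
  [/\ forall i, (0 < i < n)%N -> pi i *m pi i = - pi i,
      forall i j, (0 < i < n)%N -> (0 < j < n)%N ->
        (i.+1 < j)%N || (j.+1 < i)%N -> pi i *m pi j = pi j *m pi i &
      forall i, (0 < i)%N -> (i.+1 < n)%N ->
        pi i *m pi i.+1 *m pi i = pi i.+1 *m pi i *m pi i.+1].

Definition clifford_rel d (c : nat -> 'M[C]_d) : Prop :=
  (forall j, (0 < j <= n)%N -> c j *m c j = - 1%:M) /\
  (forall i j, (0 < i <= n)%N -> (0 < j <= n)%N -> i != j ->
     c i *m c j = - (c j *m c i)).

Definition mixed_rel d (pi c : nat -> 'M[C]_d) : Prop :=
  [/\ forall i j, (0 < i < n)%N -> (0 < j <= n)%N -> j != i -> j != i.+1 ->
        pi i *m c j = c j *m pi i,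
      forall i, (0 < i < n)%N -> pi i *m c i = c i.+1 *m pi i &
      forall i, (0 < i < n)%N ->
        (pi i + 1%:M) *m c i.+1 = c i *m (pi i + 1%:M)].

(* f is homogeneous of degree b, for homogeneous bases of parities p and p'. *)
Definition homog (b : bool) d' d (p' : 'I_d' -> bool) (p : 'I_d -> bool)
    (f : 'M[C]_(d', d)) : Prop :=
  forall i j, f i j != 0 -> p' i = b (+) p j.

Record hmod := Hmod {
  hdim : nat;
  hpi : nat -> 'M[C]_hdim;
  hmodP : hecke_rel hpi
}.

(* Every finite-dimensional superspace has a homogeneous basis; spar is the
   parity of the basis vectors (true for odd). *)
Record smod := Smod {
  sdim : nat;
  spar : 'I_sdim -> bool;
  spi : nat -> 'M[C]_sdim;
  sc : nat -> 'M[C]_sdim;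
  spiP : hecke_rel spi;
  scP : clifford_rel sc;
  smixP : mixed_rel spi sc;
  spi_even : forall i, (0 < i < n)%N -> homog false spar spar (spi i);
  sc_odd : forall j, (0 < j <= n)%N -> homog true spar spar (sc j)
}.

HB.instance Definition _ := gen_eqMixin smod.
HB.instance Definition _ := gen_choiceMixin smod.

(* Morphisms of degree b.  Odd ones are required to commute strictly with the
   c_j; composing with v |-> (-1)^|v| v turns them into odd maps that commute up
   to the sign of the super convention, and changes neither kernel nor image. *)
Definition smod_hom (b : bool) (M N : smod) (f : 'M[C]_(sdim N, sdim M)) : Prop :=
  [/\ homog b (@spar N) (@spar M) f,
      forall i, (0 < i < n)%N -> f *m spi M i = spi N i *m f &
      forall j, (0 < j <= n)%N -> f *m sc M j = sc N j *m f].

(* Homogeneous morphisms of either degree are allowed, which identifies a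
   supermodule with its parity shift in the Grothendieck group.  Without this
   identification there would be two simple classes in degree n = 0, and the
   Grothendieck group would be too large for the peak characteristic to be
   injective. *)
Definition short_exact (M' M M'' : smod) : Prop :=
  exists b1 b2 (f : 'M[C]_(sdim M, sdim M')) (g : 'M[C]_(sdim M'', sdim M)),
  [/\ smod_hom b1 f, smod_hom b2 g,
      injective (fun u : 'cV[C]_(sdim M') => f *m u),
      (forall w : 'cV[C]_(sdim M''), exists v, g *m v = w) &
      (forall v : 'cV[C]_(sdim M), g *m v = 0 <-> exists u, v = f *m u)].

(* H_n(0) is purely even, and so are its modules. *)
Definition is_Hhom (N : hmod) (M : smod) (f : 'M[C]_(sdim M, hdim N)) : Prop :=
  homog false (@spar M) (fun=> false) f /\
  forall i, (0 < i < n)%N -> f *m hpi N i = spi M i *m f.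

(* W is the induced supermodule HCl_n(0) (x)_{H_n(0)} N, given by the universal
   property of extension of scalars (left adjointness to restriction), with unit
   eta : v |-> 1 (x) v. *)
Definition is_Ind (N : hmod) (W : smod) : Prop :=
  exists2 eta : 'M[C]_(sdim W, hdim N), is_Hhom eta &
  forall (M : smod) (phi : 'M[C]_(sdim M, hdim N)), is_Hhom phi ->
    exists! psi : 'M[C]_(sdim M, sdim W),
      smod_hom false psi /\ psi *m eta = phi.

End HeckeClifford.

(* The direct sum over n of the groups G_0(HCl_n(0)): the free abelian group on
   the supermodules of all degrees n, modulo the subgroup generated by
   [M] - [M'] - [M''] for the short exact sequences in each degree. *)
Section Grothendieck.
Variable C : fieldType.

Definition free_smod : Type := {freeg {n : nat & smod C n} / int}.
HB.instance Definition _ := GRing.Zmodule.on free_smod.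

Definition free_cls n (M : smod C n) : free_smod := << Tagged (smod C) M >>.

Definition groth_rel : {pred free_smod} := fun x => `[<
  forall P : free_smod -> Prop, P 0 -> (forall u v, P u -> P v -> P (u - v)) ->
    (forall n (M' M M'' : smod C n), short_exact M' M M'' ->
       P (free_cls M - free_cls M' - free_cls M'')) ->
    P x >].

Lemma groth_rel_closed : zmod_closed groth_rel.
Proof.
split=> [|u v]; first by apply/asboolP.
move=> /asboolP Pu /asboolP Pv; apply/asboolP => P P0 PB Pse.
by apply: (PB); [apply: Pu | apply: Pv].
Qed.

HB.instance Definition _ :=
  GRing.isZmodClosed.Build free_smod groth_rel groth_rel_closed.

Definition groth : zmodType := Quotient.quot (groth_rel : zmodClosed free_smod).

Definition cls n (M : smod C n) : groth :=
  \pi_(Quotient.quot (groth_rel : zmodClosed free_smod)) (free_cls M).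

End Grothendieck.

Section SimpleH.
Variable C : fieldType.
Variable n : nat.

Definition F_pi (al : seq nat) (i : nat) : 'M[C]_1 :=
  (if i \in CDes al then - 1 else 0)%:M.

Lemma F_piP al : hecke_rel n (F_pi al).
Proof.
split=> [i _|i j _ _ _|i _ _]; rewrite /F_pi -!scalar_mxM -?rmorphN /=.
- by case: ifP => _; rewrite ?mulrNN ?mulr1 ?opprK ?mulr0 ?oppr0.
- by rewrite mulrC.
- by congr (_%:M); case: ifP; case: ifP => _ _;
     rewrite ?(mulr0, mul0r, mulrNN, mulr1).
Qed.

Definition F_mod (al : seq nat) : hmod C n := Hmod (F_piP al).
End SimpleH.

Section PeakChar.
Variable C : fieldType.

Definition qspan (S : fps -> Prop) (f : fps) : Prop :=
  exists (k : nat) (a : 'I_k -> rat) (g : 'I_k -> fps),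
    (forall j, S (g j)) /\ f = \sum_j a j *: g j.

Definition Peak_alg : fps -> Prop :=
  qspan (fun f => exists n al, is_peak_comp n al /\ f = Kpeak al).

(* The integral Grothendieck group is mapped onto a lattice of Peak which strictly
   contains the integral span of the K_al (M_al need not be simple), so that
   "isomorphism onto Peak" refers to rational scalars.  As functions are
   torsion-free, bijectivity of Q (x) G_0 -> Peak amounts to injectivity of ch
   together with the image of ch spanning Peak over Q. *)
Definition is_peak_char (ch : {additive groth C -> fps}) : Prop :=
  [/\ injective ch,
      (forall f, Peak_alg f <-> qspan (fun g => exists x, g = ch x) f) &
      forall n al (M : smod C n), is_comp n al -> is_Ind (F_mod C n al) M ->
        ch (cls M) = Kpeak (comp_of n (Peak (CDes al)))].
End PeakChar.

(* A diagram is a finite set D of boxes of Z x Z; le is its reading order. *)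
Section Diagram.
Variables (n : nat) (D : {fset int * int}) (le : rel D).

Definition filling : Type := {ffun D -> nat}.
HB.instance Definition _ := Choice.on filling.

Definition StdFill (T : filling) : Prop :=
  injective T /\ (forall m, (0 < m <= n)%N <-> exists b, T b = m).

Definition rw (T : filling) : seq nat := [seq T b | b <- sort le (enum {: D})].

Definition TDes (T : filling) : {fset nat} :=
  [fset i in iota 1 n.-1 | (index i.+1 (rw T) < index i (rw T))%N]%fset.

Definition swap (i m : nat) : nat :=
  if m == i then i.+1 else if m == i.+1 then i else m.

Definition sT (i : nat) (T : filling) : filling := [ffun b => swap i (T b)].

Variable StdTab : {fset filling}.

Definition attacking (T : filling) (i : nat) : bool := sT i T \notin StdTab.

(* Positions in the reading word are counted from 0. *)
Definition ascent_at (T : filling) (r s : nat) : Prop :=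
  (r < s < n)%N /\ nth 0%N (rw T) s = (nth 0%N (rw T) r).+1.

Definition ascent_compatible : Prop :=
  forall T T' r s, T \in StdTab -> T' \in StdTab ->
    ascent_at T r s -> ascent_at T' r s ->
    attacking T (nth 0%N (rw T) r) = attacking T' (nth 0%N (rw T') r).

Variable C : fieldType.

Definition tab (a : 'I_#|{: StdTab}|) : filling := val (enum_val a).

(* Column b of the matrix is the image of the b-th tableau under pi_i. *)
Definition N_pi (i : nat) : 'M[C]_#|{: StdTab}| :=
  \matrix_(a, b)
    if i \in TDes (tab b) then - (tab a == tab b)%:R
    else if attacking (tab b) i then 0
    else (tab a == sT i (tab b))%:R.

Hypothesis std : forall T, T \in StdTab -> StdFill T.
Hypothesis compat : ascent_compatible.

Let pos (T : filling) (v : nat) := index v (rw T).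
Let e (T : filling) : 'cV[C]_#|{: StdTab}| := \col_a (tab a == T)%:R.

Local Lemma swapP i m : (m = i /\ swap i m = i.+1)
  \/ (m = i.+1 /\ swap i m = i) \/ (m <> i /\ m <> i.+1 /\ swap i m = m).
Proof. by rewrite /swap; do 2?case: eqP => ? //; lia. Qed.

Local Lemma swapK i : involutive (swap i).
Proof. by move=> m; have := swapP i m; have := swapP i (swap i m); lia. Qed.

Local Lemma pos_sT i T v : pos (sT i T) v = pos T (swap i v).
Proof.
have rwE : rw (sT i T) = map (swap i) (rw T).
  by rewrite /rw -map_comp; apply: eq_map => b /=; rewrite ffunE.
by rewrite /pos rwE -[in LHS](swapK i v) index_map //; apply: can_inj (swapK i).
Qed.

Local Lemma sT_far i j T : (i.+1 < j)%N || (j.+1 < i)%N ->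
  sT i (sT j T) = sT j (sT i T).
Proof.
move=> ij; apply/ffunP=> b; rewrite !ffunE.
have := swapP j (T b); have := swapP i (swap j (T b)).
by have := swapP i (T b); have := swapP j (swap i (T b)); lia.
Qed.

Local Lemma sT_braid i T :
  sT i (sT i.+1 (sT i T)) = sT i.+1 (sT i (sT i.+1 T)).
Proof.
apply/ffunP=> b; rewrite !ffunE; set m := T b.
have := swapP i m; have := swapP i.+1 (swap i m).
have := swapP i (swap i.+1 (swap i m)); have := swapP i.+1 m.
have := swapP i (swap i.+1 m); have := swapP i.+1 (swap i (swap i.+1 m)).
lia.
Qed.

Local Lemma e_out T : T \notin StdTab -> e T = 0.
Proof.
move=> TS; apply/colP => a; rewrite !mxE.
by case: eqP => // aT; move: TS; rewrite -aT /tab (valP (enum_val a)).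
Qed.

Local Lemma tab_surj T : T \in StdTab -> exists b, tab b = T.
Proof.
by move=> TS; exists (enum_rank [` TS]%fset); rewrite /tab enum_rankK.
Qed.

Local Lemma tab_inj : injective tab.
Proof. by move=> a b /val_inj /enum_val_inj. Qed.

Local Lemma tab_in b : tab b \in StdTab.
Proof. exact: valP. Qed.

Local Lemma N_ext (A B : 'M[C]_#|{: StdTab}|) :
  (forall T, T \in StdTab -> A *m e T = B *m e T) -> A = B.
Proof.
move=> AB; apply/matrixP => a b; have := AB _ (tab_in b).
have eb (M : 'M[C]_#|{: StdTab}|) : (M *m e (tab b)) a 0 = M a b.
  rewrite mxE (bigD1 b) //= mxE eqxx mulr1 big1 ?addr0 // => k kb.
  by rewrite mxE (inj_eq tab_inj) (negPf kb) mulr0.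
by move=> /colP/(_ a); rewrite !eb.
Qed.

Local Lemma in_TDes T i : (0 < i < n)%N ->
  (i \in TDes T) = (pos T i.+1 < pos T i)%N.
Proof.
move=> i_n; rewrite !inE /= mem_iota.
by have -> : (1 <= i < 1 + n.-1)%N = true by lia.
Qed.

Local Lemma N_e T i : T \in StdTab -> (0 < i < n)%N ->
  N_pi i *m e T = if (pos T i.+1 < pos T i)%N then - e T else e (sT i T).
Proof.
move=> TS i_n; have [b bT] := tab_surj TS.
have eb : N_pi i *m e T = col b (N_pi i).
  apply/colP => a; rewrite !mxE (bigD1 b) //= !mxE -bT eqxx mulr1.
  rewrite big1 ?addr0 // => k kb.
  by rewrite [X in _ * X]mxE (inj_eq tab_inj) (negPf kb) mulr0.
rewrite eb -in_TDes //; apply/colP => a; rewrite !mxE bT.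
case: ifP => _; rewrite !mxE // /attacking.
by case: ifP => // sTS; have /colP/(_ a) := e_out sTS; rewrite !mxE => ->.
Qed.

Local Lemma rw_in T m : T \in StdTab -> (0 < m <= n)%N -> m \in rw T.
Proof.
move=> /std [_ /(_ m)[+ _]] m_n => /(_ m_n)[b <-].
by apply: map_f; rewrite mem_sort mem_enum.
Qed.

Local Lemma rw_size T : T \in StdTab -> size (rw T) = n.
Proof.
move=> TS; have [Tinj Tb] := std TS.
have : perm_eq (rw T) (iota 1 n).
  apply: uniq_perm; rewrite ?iota_uniq //.
    by rewrite /rw map_inj_uniq // sort_uniq enum_uniq.
  move=> m; rewrite mem_iota add1n ltnS.
  apply/idP/idP => [/mapP[b _ ->]|/rw_in ->//].
  by apply/Tb; exists b.
by move=> /perm_size ->; rewrite size_iota.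
Qed.

Local Lemma pos_inj T u v : T \in StdTab -> (0 < u <= n)%N ->
  pos T u = pos T v -> u = v.
Proof.
move=> TS u_n uv; have uT := rw_in TS u_n.
have vT : v \in rw T by rewrite -index_mem -/(pos T v) -uv index_mem.
by rewrite -(nth_index 0%N uT) -/(pos T u) uv nth_index.
Qed.

Local Lemma compatE T T' i i' : T \in StdTab -> T' \in StdTab ->
  (0 < i < n)%N -> (0 < i' < n)%N -> (pos T i < pos T i.+1)%N ->
  pos T' i' = pos T i -> pos T' i'.+1 = pos T i.+1 ->
  (sT i T \in StdTab) = (sT i' T' \in StdTab).
Proof.
move=> TS TS' i_n i_n' asc eq1 eq2.
have r0 : nth 0%N (rw T) (pos T i) = i by rewrite nth_index // rw_in //; lia.
have s0 : nth 0%N (rw T) (pos T i.+1) = i.+1.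
  by rewrite nth_index // rw_in //; lia.
have r1 : nth 0%N (rw T') (pos T i) = i'.
  by rewrite -eq1 nth_index // rw_in //; lia.
have s1 : nth 0%N (rw T') (pos T i.+1) = i'.+1.
  by rewrite -eq2 nth_index // rw_in //; lia.
have sn : (pos T i.+1 < n)%N.
  by rewrite -(rw_size TS) index_mem rw_in //; lia.
have A : ascent_at T (pos T i) (pos T i.+1).
  by rewrite /ascent_at asc sn r0 s0.
have A' : ascent_at T' (pos T i) (pos T i.+1).
  by rewrite /ascent_at asc sn r1 s1.
have := compat TS TS' A A'; rewrite r0 r1 /attacking; exact: negb_inj.
Qed.

Local Lemma swap_l i : swap i i = i.+1.
Proof. by rewrite /swap eqxx. Qed.

Local Lemma swap_r i : swap i i.+1 = i.
Proof. by have := swapP i i.+1; lia. Qed.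

Local Lemma swap_o i m : m <> i -> m <> i.+1 -> swap i m = m.
Proof. by have := swapP i m; lia. Qed.

Local Lemma N_out T i : T \notin StdTab -> N_pi i *m e T = 0.
Proof. by move=> /e_out ->; rewrite mulmx0. Qed.

Local Lemma N_desc T i : T \in StdTab -> (0 < i < n)%N ->
  (pos T i.+1 < pos T i)%N -> N_pi i *m e T = - e T.
Proof. by move=> TS i_n d; rewrite N_e // d. Qed.

Local Lemma N_asc T i : T \in StdTab -> (0 < i < n)%N ->
  (pos T i < pos T i.+1)%N -> N_pi i *m e T = e (sT i T).
Proof. by move=> TS i_n d; rewrite N_e // ifF //; lia. Qed.

Local Lemma pos_neq T u v : T \in StdTab -> (0 < u <= n)%N -> u <> v ->
  pos T u <> pos T v.
Proof. by move=> TS u_n uv /(pos_inj TS u_n). Qed.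

Local Lemma N_quad i : (0 < i < n)%N -> N_pi i *m N_pi i = - N_pi i.
Proof.
move=> i_n; apply: N_ext => T TS; rewrite mulNmx -mulmxA.
have := @pos_neq T i i.+1 TS; case: (ltngtP (pos T i) (pos T i.+1)) => [d|d|]; last lia.
  rewrite N_asc // => _.
  have [sS|sS] := boolP (sT i T \in StdTab); last first.
    by rewrite (N_out _ sS) (e_out sS) oppr0.
  by rewrite N_desc // !pos_sT swap_l swap_r.
by rewrite N_desc // mulmxN N_desc.
Qed.

Local Lemma N_far i j : (0 < i < n)%N -> (0 < j < n)%N ->
  (i.+1 < j)%N || (j.+1 < i)%N -> N_pi i *m N_pi j = N_pi j *m N_pi i.
Proof.
move=> i_n j_n ij; apply: N_ext => T TS; rewrite -!mulmxA.
have ji : (j.+1 < i)%N || (i.+1 < j)%N by rewrite orbC.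
have pos_far k l U : (k.+1 < l)%N || (l.+1 < k)%N ->
    (pos (sT k U) l.+1 = pos U l.+1) * (pos (sT k U) l = pos U l).
  by move=> kl; rewrite !pos_sT !swap_o //; lia.
have DA k l : (0 < k < n)%N -> (0 < l < n)%N -> (k.+1 < l)%N || (l.+1 < k)%N ->
    (pos T k.+1 < pos T k)%N -> (pos T l < pos T l.+1)%N ->
    N_pi k *m (N_pi l *m e T) = N_pi l *m (N_pi k *m e T).
  move=> k_n l_n kl dk dl; rewrite (@N_desc T k) // mulmxN (@N_asc T l) //.
  have [sS|sS] := boolP (sT l T \in StdTab); last first.
    by rewrite (N_out _ sS) (e_out sS) oppr0.
  by rewrite N_desc // !(pos_far l k) // orbC.
have := @pos_neq T i i.+1 TS; have := @pos_neq T j j.+1 TS.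
case: (ltngtP (pos T i) (pos T i.+1)) => [di|di|]; last lia;
case: (ltngtP (pos T j) (pos T j.+1)) => [dj|dj|]; try lia; move=> _ _.
- have AA k l : (0 < k < n)%N -> (0 < l < n)%N -> (k.+1 < l)%N || (l.+1 < k)%N ->
      (pos T k < pos T k.+1)%N -> (pos T l < pos T l.+1)%N ->
      sT l T \notin StdTab -> N_pi l *m e (sT k T) = 0.
    move=> k_n l_n kl dk dl lS.
    have [kS|kS] := boolP (sT k T \in StdTab); last by rewrite N_out.
    have A : (pos (sT k T) l < pos (sT k T) l.+1)%N by rewrite !pos_far.
    rewrite (N_asc kS l_n A); apply: e_out.
    by rewrite -(@compatE T (sT k T) l l) // pos_far.
  rewrite (N_asc TS i_n di) (N_asc TS j_n dj).
  have [iS|iS] := boolP (sT i T \in StdTab); last first.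
    by rewrite (N_out _ iS) AA.
  have [jS|jS] := boolP (sT j T \in StdTab); last by rewrite (N_out _ jS) AA.
  have Ai : (pos (sT j T) i < pos (sT j T) i.+1)%N by rewrite !pos_far.
  have Aj : (pos (sT i T) j < pos (sT i T) j.+1)%N by rewrite !pos_far.
  rewrite (N_asc jS i_n Ai) (N_asc iS j_n Aj).
  by rewrite (sT_far T ij).
- by apply/esym/DA.
- exact: DA.
- by rewrite (N_desc TS i_n di) (N_desc TS j_n dj) !mulmxN (N_desc TS i_n di)
    (N_desc TS j_n dj).
Qed.

Local Lemma N_braid i : (0 < i)%N -> (i.+1 < n)%N ->
  N_pi i *m N_pi i.+1 *m N_pi i = N_pi i.+1 *m N_pi i *m N_pi i.+1.
Proof.
move=> i0 i_n; apply: N_ext => T TS; rewrite -!mulmxA.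
have [i_n1 i_n2] : (0 < i < n)%N /\ (0 < i.+1 < n)%N by lia.
have posE U : ((pos (sT i U) i = pos U i.+1) * (pos (sT i U) i.+1 = pos U i)
   * (pos (sT i U) i.+2 = pos U i.+2) * (pos (sT i.+1 U) i = pos U i)
   * (pos (sT i.+1 U) i.+1 = pos U i.+2) * (pos (sT i.+1 U) i.+2 = pos U i.+1))%type.
  by rewrite !pos_sT !(swap_l, swap_r) !swap_o //; lia.
have pq : pos T i <> pos T i.+1 by apply: pos_neq => //; lia.
have qr : pos T i.+1 <> pos T i.+2 by apply: pos_neq => //; lia.
have pr : pos T i <> pos T i.+2 by apply: pos_neq => //; lia.
have [[p_q|q_p] [[q_r|r_q] [p_r|r_p]]] : 
   ((pos T i < pos T i.+1)%N \/ (pos T i.+1 < pos T i)%N) /\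
   ((pos T i.+1 < pos T i.+2)%N \/ (pos T i.+2 < pos T i.+1)%N) /\
   ((pos T i < pos T i.+2)%N \/ (pos T i.+2 < pos T i)%N) by lia.
all: try lia.
- rewrite (N_asc TS i_n1 p_q) (N_asc TS i_n2 q_r).
  have LHS0 : ~~ [&& sT i T \in StdTab, sT i.+1 (sT i T) \in StdTab
       & sT i (sT i.+1 (sT i T)) \in StdTab] ->
      N_pi i *m (N_pi i.+1 *m e (sT i T)) = 0.
    have [aS|/N_out-> _] := boolP (sT i T \in StdTab); last by rewrite mulmx0.
    rewrite (@N_asc (sT i T) i.+1) 9?posE //.
    have [bS|/N_out-> //] := boolP (sT i.+1 (sT i T) \in StdTab).
    by move=> cS; rewrite (@N_asc (sT i.+1 (sT i T)) i) 9?posE // e_out.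
  have RHS0 : ~~ [&& sT i.+1 T \in StdTab, sT i (sT i.+1 T) \in StdTab
       & sT i.+1 (sT i (sT i.+1 T)) \in StdTab] ->
      N_pi i.+1 *m (N_pi i *m e (sT i.+1 T)) = 0.
    have [aS|/N_out-> _] := boolP (sT i.+1 T \in StdTab); last by rewrite mulmx0.
    rewrite (@N_asc (sT i.+1 T) i) 9?posE //.
    have [bS|/N_out-> //] := boolP (sT i (sT i.+1 T) \in StdTab).
    by move=> cS; rewrite (@N_asc (sT i (sT i.+1 T)) i.+1) 9?posE // e_out.
  have LR : [&& sT i T \in StdTab, sT i.+1 (sT i T) \in StdTab
       & sT i (sT i.+1 (sT i T)) \in StdTab] =
     [&& sT i.+1 T \in StdTab, sT i (sT i.+1 T) \in StdTab
       & sT i.+1 (sT i (sT i.+1 T)) \in StdTab].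
    apply/idP/idP => /and3P[aS bS cS].
      have bT : sT i.+1 T \in StdTab.
        by rewrite (@compatE T (sT i.+1 (sT i T)) i.+1 i) 9?posE.
      rewrite -sT_braid cS bT andbT /=.
      by rewrite (@compatE _ (sT i T) i i.+1) 9?posE.
    have aT : sT i T \in StdTab.
      by rewrite (@compatE T (sT i (sT i.+1 T)) i i.+1) 9?posE.
    rewrite sT_braid cS aT andbT /=.
    by rewrite (@compatE _ (sT i.+1 T) i.+1 i) 9?posE.
  have [L|L] := boolP [&& sT i T \in StdTab, sT i.+1 (sT i T) \in StdTab
       & sT i (sT i.+1 (sT i T)) \in StdTab]; last by rewrite LHS0 // RHS0 // -LR.
  move: (L); rewrite LR => /and3P[b1 b2 _]; case/and3P: L => a1 a2 _.
  rewrite (@N_asc (sT i T) i.+1) 9?posE // (@N_asc (sT i.+1 T) i) 9?posE //.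
  by rewrite (@N_asc _ i) 9?posE // (@N_asc _ i.+1) 9?posE // sT_braid.
- rewrite (N_asc TS i_n1 p_q) (N_desc TS i_n2 r_q) !mulmxN (N_asc TS i_n1 p_q).
  have [aS|aS] := boolP (sT i T \in StdTab); last first.
    by rewrite (N_out _ aS) mulmx0 oppr0.
  rewrite (@N_asc (sT i T) i.+1) 9?posE //.
  have [bS|bS] := boolP (sT i.+1 (sT i T) \in StdTab).
    by rewrite (@N_desc _ i) 9?posE.
  by rewrite (N_out _ bS) (e_out bS) oppr0.
- rewrite (N_asc TS i_n1 p_q) (N_desc TS i_n2 r_q) !mulmxN (N_asc TS i_n1 p_q).
  have [aS|aS] := boolP (sT i T \in StdTab); last first.
    by rewrite (N_out _ aS) mulmx0 oppr0.
  rewrite (@N_desc (sT i T) i.+1) 9?posE // mulmxN.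
  by rewrite (@N_desc (sT i T) i) 9?posE.
- rewrite (N_desc TS i_n1 q_p) (N_asc TS i_n2 q_r) !mulmxN (N_asc TS i_n2 q_r).
  have [aS|aS] := boolP (sT i.+1 T \in StdTab); last first.
    by rewrite (N_out _ aS) mulmx0 oppr0.
  rewrite (@N_asc (sT i.+1 T) i) 9?posE //.
  have [bS|bS] := boolP (sT i (sT i.+1 T) \in StdTab).
    by rewrite (@N_desc _ i.+1) 9?posE.
  by rewrite (N_out _ bS) (e_out bS) oppr0.
- rewrite (N_desc TS i_n1 q_p) (N_asc TS i_n2 q_r) !mulmxN (N_asc TS i_n2 q_r).
  have [aS|aS] := boolP (sT i.+1 T \in StdTab); last first.
    by rewrite (N_out _ aS) mulmx0 oppr0.
  rewrite (@N_desc (sT i.+1 T) i) 9?posE // mulmxN.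
  by rewrite (@N_desc (sT i.+1 T) i.+1) 9?posE.
- rewrite (N_desc TS i_n1 q_p) (N_desc TS i_n2 r_q) !mulmxN (N_desc TS i_n1 q_p) (N_desc TS i_n2 r_q) !mulmxN.
  by rewrite (N_desc TS i_n1 q_p) (N_desc TS i_n2 r_q).
Qed.

Lemma N_piP : hecke_rel n N_pi.
Proof. split; [exact: N_quad|exact: N_far|exact: N_braid]. Qed.

Definition N_mod : hmod C n := Hmod N_piP.
End Diagram.

(* Main.v *)
(* Induction from H_n(0) to HCl_n(0) is exact, because HCl_n(0) is free as a right
   H_n(0)-module with basis the monomials c_X.  Concretely, Cl_n (x) N is built as
   a free Clifford module, and the action of H_n(0) on it is obtained from
   freeness: if sigma_i exchanges c_i and c_(i+1), and a_i = - (1 + c_i c_(i+1)) / 2,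
   then the mixed relations for pi_i say exactly that pi_i - a_i is sigma_i-linear
   over Cl_n.  The difference of the two sides of each Hecke relation is linear
   over Cl_n up to a permutation of the c_j and vanishes on N, hence is zero.

   The tableau basis is triangular: a nonattacking ascent strictly decreases the
   sum over v of v times the position of v in the reading word.  So N has a
   filtration with quotients F_al, Des(al) = Des(T), one for each tableau T, and
   additivity of the characteristic on the induced filtration gives the sum. *)
Require Import Defs.
From mathcomp Require Import all_boot all_order all_algebra.
From mathcomp Require Import generic_quotient ring_quotient.
From mathcomp Require Import finmap complex zify ring boolp reals.

Set Implicit Arguments.
Unset Strict Implicit.
Unset Printing Implicit Defensive.

Import GRing.Theory Num.Theory.

Local Open Scope ring_scope.

(** * Free modules over the Clifford algebra *)

Section FreeClifford.
Variable C : fieldType.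

Definition sum_parity m1 m2 (p1 : 'I_m1 -> bool) (p2 : 'I_m2 -> bool)
  (i : 'I_(m1 + m2)) : bool :=
  match split i with inl a => p1 a | inr b => p2 b end.

Lemma sum_parityl m1 m2 (p1 : 'I_m1 -> bool) (p2 : 'I_m2 -> bool) i :
  sum_parity p1 p2 (lshift m2 i) = p1 i.
Proof. by rewrite /sum_parity (unsplitK (inl _)). Qed.

Lemma sum_parityr m1 m2 (p1 : 'I_m1 -> bool) (p2 : 'I_m2 -> bool) i :
  sum_parity p1 p2 (rshift m1 i) = p2 i.
Proof. by rewrite /sum_parity (unsplitK (inr _)). Qed.

Section Homogeneous.
Variables (b : bool) (m1 m2 k1 k2 : nat).
Variables (p1 : 'I_m1 -> bool) (p2 : 'I_m2 -> bool).
Variables (q1 : 'I_k1 -> bool) (q2 : 'I_k2 -> bool).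

Lemma homog0 : homog b p1 q1 (0 : 'M[C]_(m1, k1)).
Proof. by move=> i j; rewrite mxE eqxx. Qed.

Lemma homogD (f g : 'M[C]_(m1, k1)) :
  homog b p1 q1 f -> homog b p1 q1 g -> homog b p1 q1 (f + g).
Proof.
move=> hf hg i j; rewrite mxE; have [f0|/hf //] := eqVneq (f i j) 0.
by rewrite f0 add0r => /hg.
Qed.

Lemma homogZ a (f : 'M[C]_(m1, k1)) :
  homog b p1 q1 f -> homog b p1 q1 (a *: f).
Proof. by move=> hf i j; rewrite mxE mulf_eq0 negb_or => /andP[_ /hf]. Qed.

Lemma homogN (f : 'M[C]_(m1, k1)) :
  homog b p1 q1 f -> homog b p1 q1 (- f).
Proof. by rewrite -scaleN1r; exact: homogZ. Qed.

Lemma homogM b' (f : 'M[C]_(m1, m2)) (g : 'M[C]_(m2, k1)) :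
  homog b p1 p2 f -> homog b' p2 q1 g -> homog (b (+) b') p1 q1 (f *m g).
Proof.
move=> hf hg i j; rewrite mxE => fg0.
have [l fl0] : exists l, f i l * g l j != 0.
  apply/existsP; apply: contraNT fg0 => /existsPn fg0.
  by rewrite big1 // => l _; apply/eqP; rewrite -[_ == _]negbK fg0.
move: fl0; rewrite mulf_eq0 negb_or => /andP[/hf -> /hg ->].
by rewrite addbA.
Qed.

Lemma homog_row_mx (f : 'M[C]_(m1, k1)) (g : 'M[C]_(m1, k2)) :
  homog b p1 q1 f -> homog b p1 q2 g ->
  homog b p1 (sum_parity q1 q2) (row_mx f g).
Proof.
move=> hf hg i j; case: (split_ordP j) => j' ->.
  by rewrite row_mxEl sum_parityl; exact: hf.
by rewrite row_mxEr sum_parityr; exact: hg.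
Qed.

Lemma homog_col_mx (f : 'M[C]_(m1, k1)) (g : 'M[C]_(m2, k1)) :
  homog b p1 q1 f -> homog b p2 q1 g ->
  homog b (sum_parity p1 p2) q1 (col_mx f g).
Proof.
move=> hf hg i j; case: (split_ordP i) => i' ->.
  by rewrite col_mxEu sum_parityl; exact: hf.
by rewrite col_mxEd sum_parityr; exact: hg.
Qed.

End Homogeneous.

Lemma homog1 m (p : 'I_m -> bool) : homog false p p (1%:M : 'M[C]_m).
Proof. by move=> i j; rewrite mxE; case: (i =P j) => [->|] //; rewrite eqxx. Qed.

Lemma homog_negb b m k (p : 'I_m -> bool) (q : 'I_k -> bool) (f : 'M[C]_(m, k)) :
  homog b p q f -> homog b (negb \o p) (negb \o q) f.
Proof. by move=> hf i j /hf /= ->; rewrite addbN. Qed.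

Lemma homog_negbr b m k (p : 'I_m -> bool) (q : 'I_k -> bool) (f : 'M[C]_(m, k)) :
  homog b p q f -> homog (~~ b) p (negb \o q) f.
Proof. by move=> hf i j /hf /= ->; rewrite addNb addbN negbK. Qed.

Lemma homog_negbl b m k (p : 'I_m -> bool) (q : 'I_k -> bool) (f : 'M[C]_(m, k)) :
  homog b p q f -> homog (~~ b) (negb \o p) q f.
Proof. by move=> hf i j /hf /= ->; rewrite addNb. Qed.

(* c makes C^m a free module over the Clifford algebra on c_1, ..., c_n, with
   basis the columns of eta.  In the second clause t is unconstrained: this
   gives uniqueness also for maps that are linear up to a twist. *)
Definition clifford_free n d m (p : 'I_m -> bool) (c : nat -> 'M[C]_m)
    (eta : 'M[C]_(m, d)) : Prop :=
  (forall k (t : nat -> 'M[C]_k) (phi : 'M[C]_(k, d)), clifford_rel n t ->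
     exists psi : 'M[C]_(k, m),
     [/\ psi *m eta = phi,
         forall j, (0 < j <= n)%N -> psi *m c j = t j *m psi &
         forall q, (forall j, (0 < j <= n)%N -> homog true q q (t j)) ->
           homog false q (fun=> false) phi -> homog false q p psi]) /\
  (forall k (t : nat -> 'M[C]_k) (B : 'M[C]_(k, m)),
     (forall j, (0 < j <= n)%N -> B *m c j = t j *m B) ->
     B *m eta = 0 -> B = 0).

(** Induction on [n]: the module for [n.+1] is two copies of the module for [n], the second standing
    for $c_{n+1}$ times the first. Hence $c_{n+1}$ acts by $(u,v) \mapsto (-v,u)$, while the earlier
    [c j] change sign on the second copy and parities are reversed there. *)
Lemma clifford_free_exists n d : exists m (p : 'I_m -> bool) (c : nat -> 'M[C]_m)
    (eta : 'M[C]_(m, d)),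
  [/\ clifford_rel n c, forall j, (0 < j <= n)%N -> homog true p p (c j),
      homog false p (fun=> false) eta & clifford_free n p c eta].
Proof.
elim: n => [|n [m [p [c [eta [[sqc antic] hc heta [lift uniq]]]]]]].
  exists d, (fun=> false), (fun=> 0), 1%:M; split.
  - by split=> [j|i j]; lia.
  - by move=> j; lia.
  - exact: homog1.
  - split=> [k t phi _|k t B _]; last by rewrite mulmx1.
    by exists phi; split; [rewrite mulmx1|lia|].
pose c' j := if j == n.+1 then block_mx 0 (- 1%:M) 1%:M 0
             else block_mx (c j) 0 0 (- c j).
have c'S : c' n.+1 = block_mx 0 (- 1%:M) 1%:M 0 by rewrite /c' eqxx.
have c'E j : (0 < j <= n)%N -> c' j = block_mx (c j) 0 0 (- c j).
  by move=> jn; rewrite /c' ifF //; lia.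
have casesj (P : nat -> Prop) : P n.+1 -> (forall j, (0 < j <= n)%N -> P j) ->
    forall j, (0 < j <= n.+1)%N -> P j.
  by move=> PS Pj j jn; have [->//|?] := eqVneq j n.+1; apply: Pj; lia.
exists (m + m)%N, (sum_parity p (negb \o p)), c', (col_mx eta 0); split.
- split.
    apply: (casesj) => [|j jn]; rewrite ?c'S ?c'E // mulmx_block
      !(mulmx0, mul0mx, mulNmx, mulmxN, mul1mx, mulmx1, oppr0, addr0, add0r);
      rewrite scalar_mx_block opp_block_mx oppr0 ?opprK //.
    by rewrite sqc.
  have antiS j : (0 < j <= n)%N -> c' n.+1 *m c' j = - (c' j *m c' n.+1).
    move=> jn; rewrite c'S c'E // !mulmx_block opp_block_mx.
    by rewrite !(mulmx0, mul0mx, mulNmx, mulmxN, mul1mx, mulmx1, oppr0, addr0, add0r, opprK).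
  move=> i j iN jn; move: i iN j jn.
  apply: (casesj) => [|i iN]; apply: (casesj) => [|j jn]; rewrite ?eqxx // => ij.
  - exact: antiS.
  - by rewrite antiS // opprK.
  rewrite !c'E // !mulmx_block opp_block_mx.
  rewrite !(mulmx0, mul0mx, mulNmx, mulmxN, oppr0, addr0, add0r, opprK).
  by rewrite (antic i j) // opprK.
- apply: (casesj) => [|j jn]; rewrite ?c'S ?c'E //.
    apply: homog_col_mx; apply: homog_row_mx; try exact: homog0.
      by apply: (@homog_negbr false); apply: homogN; exact: homog1.
    by apply: (@homog_negbl false); exact: homog1.
  apply: homog_col_mx; apply: homog_row_mx; try exact: homog0.
    exact: hc.
  by apply: homog_negb; apply: homogN; exact: hc.
- by apply: homog_col_mx => //; exact: homog0.
split=> [k t phi [sqt antit]|k t B Bc].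
  have trel : clifford_rel n t.
    by split=> [j jn|i j iN jn ij]; [apply: sqt|apply: antit] => //; lia.
  have [psi [psi_eta psi_c psi_h]] := lift k t phi trel.
  (* The second block is forced: a vector $c_{n+1}u$ must go to $t_{n+1}\psi(u)$. *)
  exists (row_mx psi (t n.+1 *m psi)); split.
  - by rewrite mul_row_col mulmx0 addr0.
  - apply: (casesj) => [|j jn]; rewrite ?c'S ?c'E // mul_row_block mul_mx_row.
      rewrite !(mulmx0, mulmxN, mulmx1, addr0, add0r) mulmxA sqt ?leqnn //.
      by rewrite mulNmx mul1mx.
    rewrite !(mulmx0, mulmxN, addr0, add0r) -mulmxA psi_c // !mulmxA.
    by rewrite antit ?mulNmx ?opprK //; lia.
  - move=> q hq hphi; have hpsi : homog false q p psi.
      by apply: psi_h => // j jn; apply: hq; lia.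
    apply: homog_row_mx => //; apply: (@homog_negbr true).
    by apply: (@homogM true _ _ _ _ _ _ false _ _ _ hpsi); apply: hq; lia.
rewrite -[B]hsubmxK in Bc *; move: (lsubmx B) (rsubmx B) Bc => B1 B2 Bc.
rewrite mul_row_col mulmx0 addr0 => B1eta.
have B10 : B1 = 0.
  apply: (uniq k t B1 _ B1eta) => j jn.
  have := Bc j; rewrite c'E // mul_row_block mul_mx_row !mulmx0 addr0 add0r.
  by move=> /(_ _)/eq_row_mx[]//; lia.
(* On the first copy the relation for $c_{n+1}$ reads [B2 = t n.+1 *m B1], and [B1] is already 0. *)
have := Bc n.+1; rewrite c'S mul_row_block mul_mx_row B10 !mulmx0 add0r mulmx1.
by rewrite leqnn => /(_ isT)/eq_row_mx[-> _]; rewrite row_mx0.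
Qed.
End FreeClifford.

(** For identities between linear combinations of words already in normal form: products become
    opaque matrices, and a linear identity between their entries remains. *)
Ltac mx_words :=
  rewrite -?mulmxA;
  repeat match goal with |- context [mulmx ?A ?B] =>
    let v := fresh in move: (mulmx A B) => v end;
  apply/matrixP => ? ?; rewrite !mxE; ring.

(** * Lifting 0-Hecke operators to free Clifford modules *)

Section HeckeLift.
Variable C : fieldType.

(** The spare right factor [Y] lets every word be nested to the right, the shape in which the push
    rules below rewrite. *)
Lemma mulmx_ext m1 m2 (A B : 'M[C]_(m1, m2)) :
  (forall Y : 'M_m2, A *m Y = B *m Y) -> A = B.
Proof. by move=> /(_ 1%:M); rewrite !mulmx1. Qed.

Section Push.
Variables (n m : nat) (pi c : nat -> 'M[C]_m).
Hypothesis mixed : mixed_rel n pi c.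

Lemma mixed_push0 i j k (Y : 'M_(m, k)) : (0 < i < n)%N -> (0 < j <= n)%N ->
  j != i -> j != i.+1 -> pi i *m (c j *m Y) = c j *m (pi i *m Y).
Proof. by case: mixed => H _ _ iN jn ji ji1; rewrite !mulmxA H. Qed.

Lemma mixed_pushl i k (Y : 'M_(m, k)) : (0 < i < n)%N ->
  pi i *m (c i *m Y) = c i.+1 *m (pi i *m Y).
Proof. by case: mixed => _ H _ iN; rewrite !mulmxA H. Qed.

(** The relation $(\pi_i+1)c_{i+1}=c_i(\pi_i+1)$ solved for $\pi_i c_{i+1}$. The three push rules
    move Clifford generators to the left of the [pi i]. *)
Lemma mixed_pushr i k (Y : 'M_(m, k)) : (0 < i < n)%N ->
  pi i *m (c i.+1 *m Y) = c i *m (pi i *m Y) + c i *m Y - c i.+1 *m Y.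
Proof.
case: mixed => _ _ H iN; apply/eqP; rewrite eq_sym subr_eq; apply/eqP.
by have := congr1 (mulmx^~ Y) (H i iN); rewrite /= mulmxDl mulmxDr mul1mx mulmx1
  !mulmxDl -!mulmxA.
Qed.
End Push.

Lemma clifford_rel_swap n m (c : nat -> 'M[C]_m) i : (0 < i < n)%N ->
  clifford_rel n c -> clifford_rel n (c \o swap i).
Proof.
move=> iN [sqc antic]; have sw j : (0 < j <= n)%N -> (0 < swap i j <= n)%N.
  by have := Defs.swapP i j; lia.
split=> [j /sw/sqc //|j k /sw jn /sw kn jk /=].
by apply: antic => //; rewrite (can_eq (Defs.swapK i)).
Qed.

Lemma clifford_free_hecke_gen n d m p (c : nat -> 'M[C]_m) (eta : 'M[C]_(m, d))
    i (h : 'M[C]_d) :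
  (2 : C) != 0 -> clifford_rel n c ->
  (forall j, (0 < j <= n)%N -> homog true p p (c j)) ->
  homog false p (fun=> false) eta -> clifford_free n p c eta ->
  (0 < i < n)%N ->
  exists t : 'M[C]_m, [/\ t *m eta = eta *m h, homog false p p t,
    forall j, (0 < j <= n)%N -> j != i -> j != i.+1 -> t *m c j = c j *m t,
    t *m c i = c i.+1 *m t & (t + 1%:M) *m c i.+1 = c i *m (t + 1%:M)].
Proof.
move=> two0 cP hc heta [lift _] iN; have [sqc antic] := cP.
have [i0 i1] : (0 < i <= n)%N /\ (0 < i.+1 <= n)%N by lia.
pose x := c i; pose y := c i.+1.
have xx k (Y : 'M_(m, k)) : x *m (x *m Y) = - Y.
  by rewrite mulmxA sqc // mulNmx mul1mx.
have yy k (Y : 'M_(m, k)) : y *m (y *m Y) = - Y.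
  by rewrite mulmxA sqc // mulNmx mul1mx.
have yx k (Y : 'M_(m, k)) : y *m (x *m Y) = - (x *m (y *m Y)).
  by rewrite !mulmxA antic ?mulNmx //; lia.
(* A particular solution of the mixed relations: since [x] and [y] anticommute and square to $-1$,
   $ax = ya = -(x+y)/2$ and $(a+1)y = x(a+1) = (x+y)/2$. *)
pose a := (- 2^-1) *: (1%:M + x *m y).
have ha : homog false p p a.
  apply: homogZ; apply: homogD; first exact: homog1.
  by apply: (@homogM C true _ _ _ _ p _ true); apply: hc.
have hphi : homog false p (fun=> false) (eta *m h - a *m eta).
  apply: homogD; last by apply: homogN; exact: (homogM ha heta).
  by apply: (homogM heta) => ? ?.
have hcs j : (0 < j <= n)%N -> homog true p p ((c \o swap i) j).
  by move=> jn; apply: hc; have := Defs.swapP i j; lia.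
(* The target action is permuted by [swap i], and the value prescribed on [eta] is such that adding
   [a] restores [eta *m h]. *)
have [s [s_eta s_c s_h]] := lift m (c \o swap i) (eta *m h - a *m eta)
  (clifford_rel_swap iN cP).
exists (s + a); split.
- by rewrite mulmxDl s_eta subrK.
- by apply: homogD => //; apply: s_h.
- move=> j jn ji ji1; rewrite mulmxDl mulmxDr s_c //= Defs.swap_o; try lia.
  congr (_ + _); rewrite /a -scalemxAl -scalemxAr mulmxDl mulmxDr mul1mx mulmx1.
  congr (_ *: (_ + _)); rewrite -mulmxA /y antic // 1?eq_sym //.
  by rewrite mulmxN !mulmxA /x (antic i j) 1?eq_sym // mulNmx opprK.
- rewrite mulmxDl mulmxDr s_c //= Defs.swap_l; congr (_ + _).
  rewrite /a -scalemxAl -scalemxAr -/x -/y; congr (_ *: _).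
  apply: mulmx_ext => Y; rewrite -!mulmxA !mulmxDl !mul1mx mulmxDr -!mulmxA.
  by rewrite !yx yy !mulmxN xx !opprK addrC.
rewrite -/x -/y -[X in X *m y]addrA -[X in x *m X]addrA mulmxDl mulmxDr s_c //=.
rewrite Defs.swap_r -/x; congr (_ + _); apply: mulmx_ext => Y.
rewrite -!mulmxA !mulmxDl !mul1mx mulmxDr /a -!scalemxAl -scalemxAr.
rewrite !mulmxDl mulmxDr !mul1mx -!mulmxA xx yy mulmxN.
move: (x *m Y) (y *m Y) => u v.
by apply/matrixP => k l; rewrite !mxE; field.
Qed.

(** Both actions obey the same mixed relations, whose inhomogeneous terms cancel in the difference.
    The defect of Hecke-linearity is therefore linear up to [swap i], so the uniqueness clause of
    [clifford_free] can kill it. *)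
Lemma mixed_commute n m k (pi c : nat -> 'M[C]_m) (pi' c' : nat -> 'M[C]_k)
    (psi : 'M[C]_(k, m)) i j :
  mixed_rel n pi c -> mixed_rel n pi' c' -> (0 < i < n)%N -> (0 < j <= n)%N ->
  (forall j, (0 < j <= n)%N -> psi *m c j = c' j *m psi) ->
  (psi *m pi i - pi' i *m psi) *m c j
    = c' (swap i j) *m (psi *m pi i - pi' i *m psi).
Proof.
move=> mix mix' iN jn psic.
have psiP l (Y : 'M_m) : (0 < l <= n)%N -> psi *m (c l *m Y) = c' l *m (psi *m Y).
  by move=> ln; rewrite !mulmxA psic.
have [i0 i1] : (0 < i <= n)%N /\ (0 < i.+1 <= n)%N by lia.
apply: mulmx_ext => Y; rewrite -!mulmxA !mulmxBl -!mulmxA mulmxBr.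
have [-> | [-> | [ji ji1]]] : j = i \/ j = i.+1 \/ j != i /\ j != i.+1 by lia.
- by rewrite Defs.swap_l psiP // (mixed_pushl mix) // (mixed_pushl mix') // psiP.
- rewrite Defs.swap_r psiP // (mixed_pushr mix) // (mixed_pushr mix') //.
  rewrite mulmxBr mulmxDr !psiP //; mx_words.
by rewrite Defs.swap_o ?psiP ?(mixed_push0 mix) ?(mixed_push0 mix') ?psiP //; lia.
Qed.

(** * Twisted linearity of the defects of the Hecke relations *)

Section HeckeRel.
Variables (n m : nat) (pi c : nat -> 'M[C]_m).
Hypothesis mixed : mixed_rel n pi c.

Lemma mixed_quad i j : (0 < i < n)%N -> (0 < j <= n)%N ->
  (pi i *m pi i + pi i) *m c j = c j *m (pi i *m pi i + pi i).
Proof.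
move=> iN jn; apply: mulmx_ext => Y; rewrite -!mulmxA !mulmxDl !mulmxDr -!mulmxA.
have [i0 i1] : (0 < i <= n)%N /\ (0 < i.+1 <= n)%N by lia.
have pl k (Y : 'M_(m, k)) := mixed_pushl mixed Y iN.
have pr k (Y : 'M_(m, k)) := mixed_pushr mixed Y iN.
have [-> | [-> | [ji ji1]]] : j = i \/ j = i.+1 \/ j != i /\ j != i.+1 by lia.
- rewrite !pl !pr; mx_words.
- rewrite !pr mulmxBr mulmxDr !(pl, pr); mx_words.
by rewrite !(mixed_push0 mixed).
Qed.

(** Here [c k] and [c (swap i k)] both pass [pi j] unchanged, so only the push rules for [pi i]
    produce corrections. *)
Lemma mixed_far_off i j k : (0 < i < n)%N -> (0 < j < n)%N ->
  (i.+1 < j)%N || (j.+1 < i)%N -> (0 < k <= n)%N -> k != j -> k != j.+1 ->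
  (pi i *m pi j - pi j *m pi i) *m c k
    = c (swap i k) *m (pi i *m pi j - pi j *m pi i).
Proof.
move=> iN jN ij kn kj kj1.
have [i0 i1] : (0 < i <= n)%N /\ (0 < i.+1 <= n)%N by lia.
apply: mulmx_ext => Y; rewrite -!mulmxA !mulmxBl -!mulmxA mulmxBr.
have pj l (Z : 'M_m) : (0 < l <= n)%N -> l != j -> l != j.+1 ->
    pi j *m (c l *m Z) = c l *m (pi j *m Z).
  by move=> *; apply: (mixed_push0 mixed).
have pl := mixed_pushl mixed _ iN.
have pr := mixed_pushr mixed _ iN.
have [E | [E | [ki ki1]]] : k = i \/ k = i.+1 \/ k != i /\ k != i.+1 by lia.
- by rewrite E Defs.swap_l in kj kj1 kn *; rewrite pj // !pl pj //; lia.
- rewrite E Defs.swap_r in kj kj1 kn *; rewrite pj // !pr mulmxBr mulmxDr !pj //; try lia.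
  mx_words.
by rewrite Defs.swap_o ?pj ?(mixed_push0 mixed) ?pj //; lia.
Qed.

Lemma mixed_far i j k : (0 < i < n)%N -> (0 < j < n)%N ->
  (i.+1 < j)%N || (j.+1 < i)%N -> (0 < k <= n)%N ->
  (pi i *m pi j - pi j *m pi i) *m c k
    = c (swap i (swap j k)) *m (pi i *m pi j - pi j *m pi i).
Proof.
move=> iN jN ij kn.
have [/andP[kj kj1]|kj] := boolP ((k != j) && (k != j.+1)).
  by rewrite (@Defs.swap_o j) ?mixed_far_off //; lia.
(* Now [k] is [j] or [j.+1], hence far from [i]; the preceding lemma applies with [i] and [j]
   exchanged. *)
have -> : swap i (swap j k) = swap j k.
  by apply: Defs.swap_o; have := Defs.swapP j k; lia.
by rewrite -opprB mulNmx mixed_far_off ?mulmxN //; lia.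
Qed.

(** The transposition of [i] and [i.+2], that is [swap i \o swap i.+1 \o swap i]: the twist common
    to both sides of the braid relation. *)
Definition braid_perm (i k : nat) : nat :=
  if k == i then i.+2 else if k == i.+2 then i else k.

(** The correction terms for $c_{i+2}$ contain the squares of [pi i] and [pi i.+1], which the
    quadratic relations reduce; those are therefore established first. *)
Lemma mixed_braid i k : (0 < i)%N -> (i.+1 < n)%N -> (0 < k <= n)%N ->
  pi i *m pi i = - pi i -> pi i.+1 *m pi i.+1 = - pi i.+1 ->
  (pi i *m pi i.+1 *m pi i - pi i.+1 *m pi i *m pi i.+1) *m c k
    = c (braid_perm i k) *m
      (pi i *m pi i.+1 *m pi i - pi i.+1 *m pi i *m pi i.+1).
Proof.
move=> i0 iN kn Q1 Q2.
have [iN1 iN2] : (0 < i < n)%N /\ (0 < i.+1 < n)%N by lia.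
have q1 l (Y : 'M_(m, l)) : pi i *m (pi i *m Y) = - (pi i *m Y).
  by rewrite mulmxA Q1 mulNmx.
have q2 l (Y : 'M_(m, l)) : pi i.+1 *m (pi i.+1 *m Y) = - (pi i.+1 *m Y).
  by rewrite mulmxA Q2 mulNmx.
have pl l (Y : 'M_(m, l)) := mixed_pushl mixed Y iN1.
have pr l (Y : 'M_(m, l)) := mixed_pushr mixed Y iN1.
have pl' l (Y : 'M_(m, l)) := mixed_pushl mixed Y iN2.
have pr' l (Y : 'M_(m, l)) := mixed_pushr mixed Y iN2.
have p0 l (Y : 'M_(m, l)) : pi i *m (c i.+2 *m Y) = c i.+2 *m (pi i *m Y).
  by apply: (mixed_push0 mixed) => //; lia.
have p0' l (Y : 'M_(m, l)) : pi i.+1 *m (c i *m Y) = c i *m (pi i.+1 *m Y).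
  by apply: (mixed_push0 mixed) => //; lia.
apply: mulmx_ext => Y; rewrite -!mulmxA !mulmxBl -!mulmxA mulmxBr /braid_perm.
case: (k =P i) => [->|ki]; first by rewrite !(pl, pl', p0, p0').
case: (k =P i.+2) => [->|ki2].
  rewrite !(mulmxBr, mulmxDr, mulmxN, pl, pr, pl', pr', p0, p0', q1, q2).
  mx_words.
have [->|/eqP ki1] := k =P i.+1.
  rewrite !(mulmxBr, mulmxDr, mulmxN, pl, pr, pl', pr', p0, p0', q1, q2).
  mx_words.
by rewrite !(mixed_push0 mixed) //; lia.
Qed.

End HeckeRel.
End HeckeLift.

(** * The induced supermodule and exactness of induction *)

Section Induction.
Variables (C : fieldType) (n : nat).

(** A concrete counterpart of [is_Ind]. Its universal property concerns maps linear over the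
    Clifford algebra alone, possibly up to a twist, whereas that of [is_Ind] concerns supermodule
    morphisms. *)
Definition free_over (P : hmod C n) (W : smod C n) (eta : 'M[C]_(sdim W, hdim P)) :=
  is_Hhom eta /\ clifford_free n (@spar _ _ W) (sc W) eta.

Lemma free_over_exists (P : hmod C n) : (2 : C) != 0 ->
  exists (W : smod C n) (eta : 'M[C]_(sdim W, hdim P)), free_over eta.
Proof.
move=> two0; have [m [p [c [eta [cP hc heta cfree]]]]] := clifford_free_exists C n (hdim P).
have ex i : exists t : 'M[C]_m, (0 < i < n)%N ->
   [/\ t *m eta = eta *m hpi P i, homog false p p t,
    forall j, (0 < j <= n)%N -> j != i -> j != i.+1 -> t *m c j = c j *m t,
    t *m c i = c i.+1 *m t & (t + 1%:M) *m c i.+1 = c i *m (t + 1%:M)].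
  have [iN|iN] := boolP (0 < i < n)%N; last by exists 0.
  have [t tP] := clifford_free_hecke_gen (hpi P i) two0 cP hc heta cfree iN.
  by exists t.
have [pi piP] := choice ex.
have mix : mixed_rel n pi c.
  by split=> [i j iN|i iN|i iN]; have [] := piP i iN => // _ _ H _ _; exact: H.
have pieta i : (0 < i < n)%N -> pi i *m eta = eta *m hpi P i by move=> /piP[].
have pieven i : (0 < i < n)%N -> homog false p p (pi i) by move=> /piP[].
have [_ uniq] := cfree; have [Pq Pf Pb] := hmodP P.
have quad i : (0 < i < n)%N -> pi i *m pi i = - pi i.
  move=> iN; apply/eqP; rewrite -addr_eq0; apply/eqP.
  apply: (uniq _ c) => [j jn|]; first exact: (mixed_quad mix).
  by rewrite mulmxDl -mulmxA !pieta // mulmxA pieta // -mulmxA Pq // mulmxN addNr.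
have hecke : hecke_rel n pi.
  split=> [//|i j iN jN ij|i i0 iN].
    apply/eqP; rewrite -subr_eq0; apply/eqP.
    apply: (uniq _ (fun k => c (swap i (swap j k)))) => [k kn|].
      exact: (mixed_far mix).
    rewrite mulmxBl -!mulmxA !pieta // !mulmxA !pieta // -!mulmxA Pf //.
    by rewrite subrr.
  have [iN1 iN2] : (0 < i < n)%N /\ (0 < i.+1 < n)%N by lia.
  apply/eqP; rewrite -subr_eq0; apply/eqP.
  (* The braid defect is linear up to [braid_perm i], and on [eta] it reduces to the braid relation
     in [P]. *)
  apply: (uniq _ (fun k => c (braid_perm i k))) => [k kn|].
    by apply: (mixed_braid mix) => //; apply: quad.
  have pietaA l (Y : 'M_(_, l)) j : (0 < j < n)%N ->
      pi j *m (eta *m Y) = eta *m (hpi P j *m Y).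
    by move=> jN; rewrite !mulmxA pieta.
  rewrite mulmxBl -!mulmxA !(pieta, pietaA) //.
  by rewrite -mulmxBr !mulmxA Pb // subrr mulmx0.
exists (Smod hecke cP mix pieven hc), eta; split=> //.
by split=> // i iN; rewrite /= pieta.
Qed.

Section Hom.
Variables (P : hmod C n) (W : smod C n) (eta : 'M[C]_(sdim W, hdim P)).
Hypothesis free : free_over eta.

Lemma free_over_ext (M : smod C n) (f g : 'M[C]_(sdim M, sdim W)) :
  smod_hom false f -> smod_hom false g -> f *m eta = g *m eta -> f = g.
Proof.
case: free => _ [_ uniq] [_ _ fc] [_ _ gc] fg; apply/eqP; rewrite -subr_eq0.
apply/eqP/(uniq _ (sc M)) => [j jn|]; last by rewrite mulmxBl fg subrr.
by rewrite mulmxBl mulmxBr fc ?gc.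
Qed.

(** The Clifford-linear extension of [phi] is automatically Hecke-linear: its defect is linear up to
    [swap i] and vanishes on [eta]. *)
Lemma free_over_lift (M : smod C n) (phi : 'M[C]_(sdim M, hdim P)) :
  is_Hhom phi ->
  exists2 psi : 'M[C]_(sdim M, sdim W), smod_hom false psi & psi *m eta = phi.
Proof.
case: free => -[_ etapi] [lift uniq] [hphi phipi].
have [psi [psieta psic psih]] := lift _ (sc M) phi (@scP _ _ M).
exists psi => //; split=> //; first by apply: psih => //; exact: sc_odd.
move=> i iN; apply/eqP; rewrite -subr_eq0; apply/eqP.
apply: (uniq _ (fun k => sc M (swap i k))) => [j jn|].
  exact: (mixed_commute (@smixP _ _ W) (@smixP _ _ M)).
rewrite mulmxBl -!mulmxA -etapi // psieta mulmxA psieta phipi //.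
by rewrite subrr.
Qed.

Lemma free_over_is_Ind : is_Ind P W.
Proof.
exists eta => [|M phi /free_over_lift[psi psih psieta]]; first by case: free.
exists psi; split=> // psi' [psih' psieta'].
by apply: free_over_ext => //; rewrite psieta.
Qed.
End Hom.

Lemma smod_homM b b' (M1 M2 M3 : smod C n) (f : 'M[C]_(sdim M2, sdim M1))
    (g : 'M[C]_(sdim M3, sdim M2)) :
  smod_hom b g -> smod_hom b' f -> smod_hom (b (+) b') (g *m f).
Proof.
move=> [gh gpi gc] [fh fpi fc]; split; first exact: homogM fh.
  by move=> i iN; rewrite -mulmxA fpi // !mulmxA gpi.
by move=> i iN; rewrite -mulmxA fc // !mulmxA gc.
Qed.

Lemma smod_hom1 (M : smod C n) : smod_hom false (1%:M : 'M_(sdim M)).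
Proof. by split=> [|i _|j _]; rewrite ?mul1mx ?mulmx1 //; exact: homog1. Qed.

(** The two universal properties give morphisms between [N] and a free model [W]; freeness is
    carried over to [N] because it is a retract of [W] compatibly with the units. *)
Lemma is_Ind_free (P : hmod C n) (N : smod C n) : (2 : C) != 0 -> is_Ind P N ->
  exists eta : 'M[C]_(sdim N, hdim P), free_over eta.
Proof.
move=> two0 [eta etaH univ]; have [W [eta' free']] := free_over_exists P two0.
have [etaH' [lift uniq]] := free'.
have [psi [[psih psieta] _]] := univ W eta' etaH'.
have [psi' psih' psieta'] := free_over_lift free' etaH.
(* Both sides are endomorphisms of [N] fixing [eta], so the uniqueness in [is_Ind] identifies
   them. *)
have psi'K : psi' *m psi = 1%:M.
  have [u [_ univN]] := univ N eta etaH.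
  rewrite -(univN (psi' *m psi)); first apply: univN.
    by split; [exact: smod_hom1|rewrite mul1mx].
  by split; [exact: (smod_homM psih' psih)|rewrite -mulmxA psieta].
exists eta; split=> //; split=> [k t phi tP|k t B Bc Beta].
  have [chi [chieta chic chih]] := lift k t phi tP.
  exists (chi *m psi); split.
  - by rewrite -mulmxA psieta.
  - by case: psih => _ _ psic j jn; rewrite -mulmxA psic // !mulmxA chic.
  - by case: psih => + _ _ q qt hphi => /(homogM (chih q qt hphi)).
have Bpsi : B *m psi' = 0.
  case: psih' => _ _ psic'; apply: (uniq _ t) => [j jn|].
    by rewrite -mulmxA psic' // !mulmxA Bc.
  by rewrite -mulmxA psieta'.
by rewrite -[B]mulmx1 -psi'K mulmxA Bpsi mul0mx.
Qed.

(** The maps [r] and [s] split the sequence only linearly, but they still lift to Clifford-linear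
    maps. The splitting identities hold on the units, hence on the induced modules, and exactness
    follows from them. *)
Lemma free_over_short_exact (P' P P'' : hmod C n) (N' N N'' : smod C n)
    (eta' : 'M[C]_(sdim N', hdim P')) (eta : 'M[C]_(sdim N, hdim P))
    (eta'' : 'M[C]_(sdim N'', hdim P''))
    (f : 'M[C]_(hdim P, hdim P')) (r : 'M[C]_(hdim P', hdim P))
    (g : 'M[C]_(hdim P'', hdim P)) (s : 'M[C]_(hdim P, hdim P'')) :
  free_over eta' -> free_over eta -> free_over eta'' ->
  (forall i, (0 < i < n)%N -> f *m hpi P' i = hpi P i *m f) ->
  (forall i, (0 < i < n)%N -> g *m hpi P i = hpi P'' i *m g) ->
  r *m f = 1%:M -> g *m s = 1%:M -> g *m f = 0 -> f *m r + s *m g = 1%:M ->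
  short_exact N' N N''.
Proof.
move=> F' F F'' fpi gpi rf gs gf frsg.
have liftH (Q Q' : hmod C n) (V V' : smod C n) (e : 'M[C]_(sdim V, hdim Q))
    (e' : 'M[C]_(sdim V', hdim Q')) (h : 'M[C]_(hdim Q', hdim Q)) :
    free_over e -> free_over e' ->
    (forall i, (0 < i < n)%N -> h *m hpi Q i = hpi Q' i *m h) ->
    exists2 H : 'M[C]_(sdim V', sdim V), smod_hom false H & H *m e = e' *m h.
  move=> Fe [[he' epi'] _] hh; apply: (free_over_lift Fe); split.
    by apply: (homogM he') => ? ?.
  by move=> i iN; rewrite -mulmxA hh // !mulmxA epi'.
have liftC (Q Q' : hmod C n) (V V' : smod C n) (e : 'M[C]_(sdim V, hdim Q))
    (e' : 'M[C]_(sdim V', hdim Q')) (h : 'M[C]_(hdim Q', hdim Q)) :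
    free_over e -> exists2 H : 'M[C]_(sdim V', sdim V),
      forall j, (0 < j <= n)%N -> H *m sc V j = sc V' j *m H & H *m e = e' *m h.
  move=> [_ [lift _]].
  by have [H [? ? _]] := lift _ (sc V') (e' *m h) (@scP _ _ V'); exists H.
have uniq (Q : hmod C n) (V V' : smod C n) (e : 'M[C]_(sdim V, hdim Q))
    (A B : 'M[C]_(sdim V', sdim V)) : free_over e ->
    (forall j, (0 < j <= n)%N -> A *m sc V j = sc V' j *m A) ->
    (forall j, (0 < j <= n)%N -> B *m sc V j = sc V' j *m B) ->
    A *m e = B *m e -> A = B.
  move=> [_ [_ uniq]] Ac Bc AB; apply/eqP; rewrite -subr_eq0; apply/eqP.
  apply: (uniq _ (sc V')) => [j jn|]; last by rewrite mulmxBl AB subrr.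
  by rewrite mulmxBl mulmxBr Ac ?Bc.
have [Hf hf ef] := liftH _ _ _ _ _ _ f F' F fpi.
have [Hg hg eg] := liftH _ _ _ _ _ _ g F F'' gpi.
have [Hr cr er] := liftC _ _ _ _ _ eta' r F.
have [Hs cs es] := liftC _ _ _ _ _ eta s F''.
have [_ _ cf] := hf; have [_ _ cg] := hg.
have comp (V V' V'' : smod C n) (A : 'M[C]_(sdim V', sdim V))
    (B : 'M[C]_(sdim V'', sdim V')) :
    (forall j, (0 < j <= n)%N -> A *m sc V j = sc V' j *m A) ->
    (forall j, (0 < j <= n)%N -> B *m sc V' j = sc V'' j *m B) ->
    (forall j, (0 < j <= n)%N -> (B *m A) *m sc V j = sc V'' j *m (B *m A)).
  by move=> Ac Bc j jn; rewrite -mulmxA Ac // !mulmxA Bc.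
have id1 (V : smod C n) j : (0 < j <= n)%N ->
    1%:M *m sc V j = sc V j *m (1%:M : 'M_(sdim V)) by rewrite mul1mx mulmx1.
have Hrf : Hr *m Hf = 1%:M.
  apply: (uniq _ _ _ _ _ _ F' (comp _ _ _ _ _ cf cr) (id1 _)).
  by rewrite mul1mx -mulmxA ef mulmxA er -mulmxA rf mulmx1.
have Hgs : Hg *m Hs = 1%:M.
  apply: (uniq _ _ _ _ _ _ F'' (comp _ _ _ _ _ cs cg) (id1 _)).
  by rewrite mul1mx -mulmxA es mulmxA eg -mulmxA gs mulmx1.
have Hgf : Hg *m Hf = 0.
  apply: (uniq _ _ _ _ _ _ F' (comp _ _ _ _ _ cf cg)).
    by move=> j _; rewrite mul0mx mulmx0.
  by rewrite mul0mx -mulmxA ef mulmxA eg -mulmxA gf mulmx0.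
have Hfrsg : Hf *m Hr + Hs *m Hg = 1%:M.
  apply: (uniq _ _ _ _ _ _ F) (id1 _) _.
    by move=> j jn; rewrite mulmxDl mulmxDr !(comp _ _ _ _ _ _ _ _ jn).
  rewrite mul1mx mulmxDl -!mulmxA er eg !mulmxA ef es -!mulmxA -mulmxDr frsg.
  by rewrite mulmx1.
exists false, false, Hf, Hg; split=> //.
- by move=> u v /(congr1 (mulmx Hr)); rewrite !mulmxA Hrf !mul1mx.
- by move=> w; exists (Hs *m w); rewrite mulmxA Hgs mul1mx.
move=> v; split=> [Hgv|[u ->]]; last by rewrite mulmxA Hgf mul0mx.
(* Applied to [v] with [Hg *m v = 0], the lifted splitting identity leaves only the term through
   [Hf]. *)
exists (Hr *m v); rewrite -[LHS]mul1mx -Hfrsg mulmxDl -!mulmxA Hgv mulmx0 addr0.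
by [].
Qed.

End Induction.

(** * Characteristics of extensions and of triangular modules *)

Lemma cls_short_exact (C : fieldType) n (M' M M'' : smod C n) :
  short_exact M' M M'' -> cls M = cls M' + cls M''.
Proof.
move=> se; apply/eqP; rewrite -subr_eq0 opprD addrA /cls -!raddfB /=.
rewrite -(raddf0 (\pi_(Quotient.quot (@groth_rel C : zmodClosed (free_smod C)))%qT)).
rewrite -Quotient.idealrBE subr0; apply/asboolP => P P0 PB; exact.
Qed.

(** The relations may be tested after composing with [g], which has the right inverse [s]; there
    words in [pi'] turn into words in [pi]. *)
Lemma hecke_rel_quotient (C : fieldType) n d d' (pi : nat -> 'M[C]_d)
    (pi' : nat -> 'M[C]_d') (g : 'M[C]_(d', d)) (s : 'M[C]_(d, d')) :
  g *m s = 1%:M -> (forall i, (0 < i < n)%N -> g *m pi i = pi' i *m g) ->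
  hecke_rel n pi -> hecke_rel n pi'.
Proof.
move=> gs gpi [Pq Pf Pb].
have push i k (Y : 'M_(d, k)) : (0 < i < n)%N ->
    pi' i *m (g *m Y) = g *m (pi i *m Y) by move=> iN; rewrite !mulmxA gpi.
have ext (A B : 'M[C]_d') : A *m (g *m s) = B *m (g *m s) -> A = B.
  by rewrite gs !mulmx1.
split=> [i iN|i j iN jN ij|i i0 iN]; apply: ext; rewrite ?mulNmx -!mulmxA.
- by rewrite !push // [pi i *m _]mulmxA Pq // mulNmx mulmxN.
- by rewrite !push // [pi i *m _]mulmxA Pf // -mulmxA.
have [iN1 iN2] : (0 < i < n)%N /\ (0 < i.+1 < n)%N by lia.
by rewrite !push //; congr (g *m _); rewrite !mulmxA Pb.
Qed.

Section Triangular.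
Variables (R : realType) (ch : {additive groth R[i] -> fps}).
Hypothesis chP : is_peak_char ch.

Lemma ch_split n (P' P P'' : hmod R[i] n) (N' N N'' : smod R[i] n)
    (f : 'M[R[i]]_(hdim P, hdim P')) (r : 'M[R[i]]_(hdim P', hdim P))
    (g : 'M[R[i]]_(hdim P'', hdim P)) (s : 'M[R[i]]_(hdim P, hdim P'')) :
  is_Ind P' N' -> is_Ind P N -> is_Ind P'' N'' ->
  (forall i, (0 < i < n)%N -> f *m hpi P' i = hpi P i *m f) ->
  (forall i, (0 < i < n)%N -> g *m hpi P i = hpi P'' i *m g) ->
  r *m f = 1%:M -> g *m s = 1%:M -> g *m f = 0 -> f *m r + s *m g = 1%:M ->
  ch (cls N) = ch (cls N') + ch (cls N'').
Proof.
have two0 : (2 : R[i]) != 0 by rewrite pnatr_eq0.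
move=> /(is_Ind_free two0)[e' F'] /(is_Ind_free two0)[e F].
move=> /(is_Ind_free two0)[e'' F''] fpi gpi rf gs gf frsg.
rewrite -raddfD; congr (ch _); apply: cls_short_exact.
exact: (free_over_short_exact F' F F'' fpi gpi rf gs gf frsg).
Qed.

(* Split off the basis vector that minimizes w: it spans a submodule. *)
Lemma ch_triangular n d (pi : nat -> 'M[R[i]]_d) (piP : hecke_rel n pi)
    (X : 'I_d -> {fset nat}) (w : 'I_d -> nat) (N : smod R[i] n) :
  (forall b x, x \in X b -> (0 < x < n)%N) ->
  (forall i b, (0 < i < n)%N -> pi i b b = if i \in X b then -1 else 0) ->
  (forall i a b, (0 < i < n)%N -> a != b -> pi i a b != 0 -> (w a < w b)%N) ->
  is_Ind (Hmod piP) N ->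
  ch (cls N) = \sum_(b < d) Kpeak (comp_of n (Peak (X b))).
Proof.
elim: d pi piP X w N => [|d IH] pi piP X w N XP diag tri NP.
  have z (A B : 'M[R[i]]_0) : A = B by apply/matrixP => -[].
  (* The zero module is an extension of itself by itself, so its characteristic equals twice itself
     and vanishes. *)
  have /esym/eqP := @ch_split n (Hmod piP) (Hmod piP) (Hmod piP) N N N 0 0 0 0
    NP NP NP (fun _ _ => z _ _) (fun _ _ => z _ _) (z _ _) (z _ _) (z _ _) (z _ _).
  by rewrite big_ord0 -subr_eq0 addrK => /eqP.
have two0 : (2 : R[i]) != 0 by rewrite pnatr_eq0.
have [b0 _ b0min] := arg_minnP w (erefl (predT (@ord0 d))).
pose al := comp_of n (X b0); have [alP alX] := comp_ofP (XP b0).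
pose f : 'M[R[i]]_(d.+1, 1) := delta_mx b0 0.
pose r : 'M[R[i]]_(1, d.+1) := delta_mx 0 b0.
(* [g] deletes the coordinate [b0], and [s] reinserts it with value 0. *)
pose g : 'M[R[i]]_(d, d.+1) := rowsub (fintype.lift b0) 1%:M.
pose s : 'M[R[i]]_(d.+1, d) := colsub (fintype.lift b0) 1%:M.
have rf : r *m f = 1%:M.
  by rewrite mul_delta_mx; apply/matrixP => i j; rewrite !ord1 !mxE.
have gs : g *m s = 1%:M.
  rewrite /g mul_rowsub_mx mul1mx; apply/matrixP => i j; rewrite !mxE.
  by rewrite (inj_eq lift_inj).
have gf : g *m f = 0.
  rewrite /g mul_rowsub_mx mul1mx; apply/matrixP => i j; rewrite !mxE.
  by rewrite eq_sym (negPf (neq_lift _ _)).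
have frsg : f *m r + s *m g = 1%:M.
  apply/matrixP => i j; rewrite -[RHS]/((1%:M : 'M_d.+1) i j) -[1%:M]mulmx1.
  rewrite mxE [RHS]mxE (bigD1_ord b0) //= mul_delta_mx; congr (_ + _).
    by rewrite !mxE -natrM mulnb [b0 == j]eq_sym.
  by rewrite mxE; apply: eq_bigr => k _; rewrite !mxE.
(* A nonzero entry of column [b0] off the diagonal would give a weight below the minimum, so [f]
   spans a submodule isomorphic to [F_mod] of [al]. *)
have pif i : (0 < i < n)%N -> f *m F_pi R[i] al i = pi i *m f.
  move=> iN; rewrite -colE /F_pi mul_mx_scalar alX -diag //.
  apply/colP => a; rewrite !mxE; have [->|ab] := eqVneq a b0.
    by rewrite eqxx mulr1.
  rewrite /= mulr0; apply/esym/eqP.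
  by apply: contraT => /(tri i _ _ iN ab); rewrite ltnNge b0min.
pose pi' i := g *m pi i *m s.
have pig i : (0 < i < n)%N -> g *m pi i = pi' i *m g.
  move=> iN; rewrite /pi' -mulmxA.
  (* The term with [f *m r] drops out, since [pi i] preserves the line spanned by [f] and [g] kills
     that line. *)
  have -> : s *m g = 1%:M - f *m r by rewrite -frsg addrC addKr.
  rewrite mulmxBr mulmx1 -[X in _ - X]mulmxA [pi i *m _]mulmxA -pif //.
  by rewrite !mulmxA gf !mul0mx subr0.
have pi'E i a b : pi' i a b = pi i (fintype.lift b0 a) (fintype.lift b0 b).
  by rewrite /pi' mulmx_colsub mulmx1 /g mul_rowsub_mx mul1mx !mxE.
have pi'P := hecke_rel_quotient gs pig piP.
have [W [e /free_over_is_Ind We]] := free_over_exists (F_mod R[i] n al) two0.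
have [V [e' /free_over_is_Ind Ve']] := free_over_exists (Hmod pi'P) two0.
rewrite (@ch_split n (F_mod R[i] n al) (Hmod piP) (Hmod pi'P) W N V f r g s) //.
rewrite (bigD1_ord b0) //=; congr (_ + _).
  by case: chP => _ _ chF; rewrite (chF n al W alP We) alX.
apply: (IH pi' pi'P (X \o fintype.lift b0) (w \o fintype.lift b0)).
- by move=> b x; apply: XP.
- by move=> i b iN; rewrite pi'E diag.
- by move=> i a b iN ab; rewrite pi'E => /tri; apply; rewrite ?(inj_eq lift_inj).
- exact: Ve'.
Qed.

End Triangular.

(** * The weight of a reading word and the sum over tableaux *)

Definition rw_weight (n : nat) (D : {fset int * int}) (le : rel D)
    (T : filling D) : nat :=
  \sum_(v < n.+1) index (v : nat) (rw le T) * v.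

(** If [i] and [i.+1] stand at positions $p<q$, the exchange replaces $pi+q(i+1)$ by $qi+p(i+1)$, a
    drop of $q-p$. *)
Lemma rw_weight_sT n (D : {fset int * int}) (le : rel D) (T : filling D) i :
  (i < n)%N -> (index i (rw le T) < index i.+1 (rw le T))%N ->
  (rw_weight n le (sT i T) < rw_weight n le T)%N.
Proof.
move=> iN asc; pose k := Ordinal (leqW iN : (i < n.+1)%N).
pose k' := Ordinal (iN : (i.+1 < n.+1)%N).
have kk' : k' != k by rewrite -val_eqE /=; lia.
rewrite /rw_weight (bigD1 k) //= (bigD1 k') //= [X in (_ < X)%N](bigD1 k) //=.
rewrite [X in (_ < _ + X)%N](bigD1 k') //= !Defs.pos_sT Defs.swap_l Defs.swap_r.
rewrite !addnA (eq_bigr (fun v : 'I_n.+1 => index (v : nat) (rw le T) * v)%N).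
  by rewrite ltn_add2r; nia.
move=> v /andP[vk vk']; rewrite Defs.pos_sT Defs.swap_o // => E.
  by rewrite -val_eqE /= E eqxx in vk.
by rewrite -val_eqE /= E eqxx in vk'.
Qed.

Theorem theorem3p12 (R : realType) (ch : {additive groth R[i] -> fps})
    (chP : is_peak_char ch)
    (n : nat) (D : {fset int * int}) (Dn : #|` D|%fset = n)
    (le : rel D) (le_anti : antisymmetric le) (le_trans : transitive le)
    (le_total : total le)
    (StdTab : {fset filling D}) (StdTab_neq0 : StdTab != fset0)
    (std : forall T : filling D, T \in StdTab -> StdFill n T)
    (compat : ascent_compatible n le StdTab)
    (N : smod R[i] n) (NP : is_Ind (N_mod R[i] std compat) N) :
  ch (cls N) =
    \sum_(T <- StdTab) Kpeak (comp_of n (Peak (TDes n le T))).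
Proof.
(* The sum is reindexed by the enumeration of [StdTab] that indexes the matrices of [N_mod]. *)
rewrite big_seq_fsetE /= (big_enum_val (A := {: StdTab})).
have asc i (b : 'I_#|{: StdTab}|) : (0 < i < n)%N -> i \notin TDes n le (tab b) ->
    (rw_weight n le (sT i (tab b)) < rw_weight n le (tab b))%N.
  move=> iN; rewrite Defs.in_TDes // -leqNgt => le_i.
  apply: rw_weight_sT; first lia.
  rewrite ltn_neqAle le_i andbT; apply/eqP.
  by apply: (Defs.pos_neq std (Defs.tab_in b)); lia.
apply: (@ch_triangular R ch chP n _ _ _ (fun b => TDes n le (tab b))
  (fun b => rw_weight n le (tab b)) N _ _ _ NP).
- by move=> b x; rewrite !inE mem_iota => /andP[]; lia.
(* An ascent has diagonal entry 0: [tab b = sT i (tab b)] would contradict the strict drop in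
   weight. *)
- move=> i b iN; rewrite mxE eqxx; case: ifPn => // /(asc _ _ iN) lt_w.
  by case: ifP => // _; case: eqP => // E; rewrite -E ltnn in lt_w.
(* Off the diagonal, a nonzero entry forces [tab a = sT i (tab b)] at an ascent, where the weight
   drops. *)
move=> i a b iN ab; rewrite mxE (inj_eq (@Defs.tab_inj _ _)) (negPf ab) oppr0.
case: ifPn => [|/(asc _ _ iN)]; first by rewrite eqxx.
case: ifP => [_|_]; first by rewrite eqxx.
by have [->|] := eqVneq (tab a) (sT i (tab b)); rewrite ?eqxx.
Qed.
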